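(* Let $\mathcal{H}$ be a real Hilbert space, let $A, B: \mathcal{H} \rightrightarrows \mathcal{H}$ be maximally monotone operators, let $D: \mathcal{H} \to \mathcal{H}$ be a monotone and $\eta^{-1}$-Lipschitz continuous operator with $\eta > 0$, and suppose that $C := \operatorname{zer} B \neq \emptyset$. Let $(\lambda_n)_{n \in \mathbb{N}}$ and $(\beta_n)_{n\in\mathbb{N}}$ be sequences of positive real numbers. Assume that: (i) $A + N_C$ is maximally monotone and $\operatorname{zer}(A + D + N_C) \neq \emptyset$; (ii) for every $p \in \operatorname{Ran} N_C$, $\displaystyle\sum_{n \in \mathbb{N}} \lambda_n \beta_n \left( \sup_{\tilde u \in C} \varphi_B\left(\tilde u, \frac{p}{\beta_n}\right) - \sigma_C\left(\frac{p}{\beta_n}\right) \right) < +\infty$; (iii) $(\lambda_n)_{n\in\mathbb{N}} \in \ell^2 \setminus \ell^1$. Let $x_1 \in \mathcal{H}$ be arbitrary and let $(x_n)_{n\in\mathbb{N}}$, $(y_n)_{n\in\mathbb{N}}$, $(p_n)_{n\in\mathbb{N}}$, $(q_n)_{n\in\mathbb{N}}$ be generated, for all $n \geq 1$, by $$y_n = x_n - \lambda_n D x_n, \quad p_n = J_{\lambda_n A}\, y_n, \quad q_n = p_n - \lambda_n D p_n, \quad x_{n+1} = J_{\lambda_n \beta_n B}(x_n - y_n + q_n).$$ Define $\tau_n = \sum_{k=1}^n \lambda_k$ and $z_n = \frac{1}{\tau_n} \sum_{k=1}^n \lambda_k x_k$ for all $n \in \mathbb{N}$. Then $(z_n)_{n\in\mathbb{N}}$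 converges weakly to an element of $\operatorname{zer}(A + D + N_C)$ as $n \to +\infty$.
   Context: $\mathbb{N} = \{1,2,\ldots\}$. For a set-valued operator $M:\mathcal{H} \rightrightarrows \mathcal{H}$: $\operatorname{Graph} M = \{(x,u) : u \in Mx\}$, $\operatorname{Ran} M = \bigcup_{x\in\mathcal{H}} Mx$, $\operatorname{zer} M = \{x : 0 \in Mx\}$. $M$ is monotone if $\langle x-y, u-v\rangle \ge 0$ for all $(x,u),(y,v)\in\operatorname{Graph} M$, and maximally monotone if moreover its graph has no proper monotone extension in $\mathcal{H}\times\mathcal{H}$. The resolvent is $J_M = (\operatorname{Id}+M)^{-1}$, which is single-valued with full domain when $M$ is maximally monotone. The normal cone is $N_C(x)=\{u : \langle u,y-x\rangle\le 0 \text{ for all } y\in C\}$ if $x\in C$ and $N_C(x)=\emptyset$ otherwise; the support function is $\sigma_C(u)=\sup_{y\in C}\langle u,y\rangle$. The Fitzpatrick function of $B$ is $\varphi_B(x,u)=\sup\{\langle x,v\rangle+\langle y,u\rangle-\langle y,v\rangle : (y,v)\in\operatorname{Graph} B\}$, with values in $\mathbb{R}\cup\{\pm\infty\}$. *)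

(* Defs.v *)
From HB Require Import structures.
From mathcomp Require Import all_boot all_order all_algebra.
From mathcomp Require Import all_classical all_reals all_analysis.

Set Implicit Arguments.
Unset Strict Implicit.
Unset Printing Implicit Defensive.

Import Order.TTheory GRing.Theory Num.Theory.
Import numFieldNormedType.Exports.

Local Open Scope classical_set_scope.
Local Open Scope ring_scope.

(* A real Hilbert space is given by a complete normed space H together with an
   inner product dot : {dot H for idfun} (symmetric, bilinear, positive
   definite) that induces its norm. *)
Definition induces_norm (R : realType) (H : completeNormedModType R)
    (dot : {dot H for idfun}) : Prop :=
  forall x : H, `|x| ^+ 2 = dot x x.

Section SetValuedOperators.
Context {R : realType} {H : completeNormedModType R}.
Implicit Types (M N : H -> set H) (x y u : H).

Definition graph M : set (H * H) := [set xu | M xu.1 xu.2].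

Definition ran M : set H := \bigcup_x M x.

Definition zer M : set H := [set x | M x 0].

Definition op_fun (f : H -> H) : H -> set H := fun x => [set f x].

Definition op_add M N : H -> set H :=
  fun x => [set u + v | u in M x & v in N x].

Definition op_scale (c : R) M : H -> set H := fun x => [set c *: u | u in M x].

Definition op_inv M : H -> set H := fun u => [set x | M x u].

(* The set [op_inv (op_add (op_fun idfun) M) y] is a singleton for every y as soon as M is
   maximally monotone; the default value 0 plays no role then. *)
Definition resolvent M : H -> H :=
  fun y => xget 0 (op_inv (op_add (op_fun idfun) M) y).

End SetValuedOperators.

Section MonotoneOperators.
Context {R : realType} {H : completeNormedModType R}.
Variable dot : {dot H for idfun}.
Implicit Types (M N B : H -> set H) (C : set H) (x y u v : H).

Definition monotone_op M : Prop :=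
  forall x u y v, graph M (x, u) -> graph M (y, v) -> 0 <= dot (x - y) (u - v).

Definition maximally_monotone_op M : Prop :=
  monotone_op M /\
  forall N, monotone_op N -> graph M `<=` graph N -> graph N = graph M.

Definition normal_cone C : H -> set H :=
  fun x => [set u | C x /\ forall y, C y -> dot u (y - x) <= 0].

Definition support_fun C u : \bar R := ereal_sup [set (dot u y)%:E | y in C].

Definition fitzpatrick B x u : \bar R :=
  ereal_sup [set (dot x yv.2 + dot yv.1 u - dot yv.1 yv.2)%:E | yv in graph B].

Definition weakly_converges (z : nat -> H) x : Prop :=
  forall u, dot (z n) u @[n --> \oo] --> dot x u.

End MonotoneOperators.

(* Sequences are indexed by n >= 1; their value at 0 is ignored. *)
Definition ell (R : realType) (p : nat) (a : nat -> R) : Prop :=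
  (\sum_(1 <= n <oo) (`|a n| ^+ p)%:E < +oo)%E.

(* Main.v *)
Require Import Defs.
From mathcomp Require Import all_boot all_order all_algebra.
From mathcomp Require Import all_classical all_reals all_analysis.
From mathcomp Require Import ring lra.
Import Order.TTheory GRing.Theory Num.Theory.
Import numFieldNormedType.Exports.
Local Open Scope classical_set_scope.
Local Open Scope ring_scope.

(** The algorithm is a forward-backward-forward step for [A + D] followed by a
    backward step on the penalty operator [beta_n B].  Let [u] be a point of
    [C], let [v] be in [A u] and [w] in [N_C u], and put [g = v + w + D u].
    Monotonicity of [A] and of [D], together with the definition of the
    Fitzpatrick function of [B], gives ([tseng_step]), as soon as [lambda_n] is
    small compared to [eta],

      |x_(n+1) - u|^2 <= |x_n - u|^2 + 2 lambda_n <g, u - x_n> + e_n,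

    where [e_n] is a combination of [lambda_n^2] and of the gap between the
    Fitzpatrick function and the support function, and is summable because the
    penalty gaps are and [lambda] is in l^2.  This basic inequality is the
    content of [quasi_fejer_pair], and it is used twice.

    - If [g = 0], that is, if [u] is a solution, then [|x_n - u|^2] converges
      ([quasi_fejer_cvg]).  Hence the sequence is bounded, and so
      [<x_n, a - b>] converges for any two solutions [a] and [b]; its weighted
      means [<z_n, a - b>] have the same limit because the weights are not
      summable ([weighted_mean_cvg]).
    - For an arbitrary [g], summing over [n] and dividing by [tau_n] shows that
      every weak cluster point [l] of [z_n] satisfies [0 <= <u - l, g>]
      ([quasi_fejer_pair_cluster]).  Since [A + N_C] is maximally monotone and
      [D] is Lipschitz, this forces [l] to be a solution
      ([related_zero_add_lipschitz]).

    Two weak cluster points [a] and [b] are therefore solutions with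
    [<a, a - b> = <b, a - b>], so they are equal, and the bounded sequence [z_n]
    converges weakly ([opial]).

    Two classical theorems on Hilbert spaces are needed on the way.  The
    resolvents make sense, and related points are zeros, by Minty's theorem
    ([minty]).  Weak cluster points exist because scalar products with a bounded
    sequence converge along any ultrafilter, to a functional that Riesz's
    theorem represents ([riesz_representation], [weak_limit_ultra]).  Both
    Minty's and Riesz's theorems are deduced from one minimization result,
    [exists_proximal_point], whose proof is the parallelogram law. *)

Set Implicit Arguments.
Unset Strict Implicit.
Unset Printing Implicit Defensive.

(** * Inner products and proximal minimization *)

Section InnerProduct.
Context {R : realType} {H : completeNormedModType R}.
Variable dot : {dot H for idfun}.
Hypothesis Hdot : induces_norm dot.
Implicit Types (x y u v w : H) (a c : R).

Lemma dotDl x y u : dot (x + y) u = dot x u + dot y u.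
Proof. exact: linearDl. Qed.

Lemma dotNl x u : dot (- x) u = - dot x u.
Proof. exact: linearNl. Qed.

Lemma dotZl a x u : dot (a *: x) u = a * dot x u.
Proof. exact: linearZl_LR. Qed.

Lemma dotC x u : dot x u = dot u x.
Proof. by rewrite hermC expr0 mul1r. Qed.

Lemma dotDr x y u : dot u (x + y) = dot u x + dot u y.
Proof. by rewrite dotC dotDl !(dotC u). Qed.

Lemma dotNr x u : dot u (- x) = - dot u x.
Proof. by rewrite dotC dotNl (dotC u). Qed.

Lemma dotZr a x u : dot u (a *: x) = a * dot u x.
Proof. by rewrite dotC dotZl (dotC u). Qed.

Definition dotE := (dotDl, dotDr, dotNl, dotNr, dotZl, dotZr).

Lemma dot_ge0 x : 0 <= dot x x.
Proof. by rewrite -Hdot sqr_ge0. Qed.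

Lemma dot0l x : dot 0 x = 0.
Proof. exact: linear0l. Qed.

Lemma dot0r x : dot x 0 = 0.
Proof. by rewrite dotC dot0l. Qed.

Lemma dot_eq0 x : dot x x <= 0 -> x = 0.
Proof.
rewrite -Hdot => h; apply/eqP; rewrite -normr_eq0 -(sqrf_eq0 `|x|).
by rewrite eq_le h sqr_ge0.
Qed.

(** The Cauchy-Schwarz inequality is read off the triangle inequality, which
    the norm satisfies by assumption. *)
Lemma dot_le_norm x y : dot x y <= `|x| * `|y|.
Proof.
have : `|x + y| ^+ 2 <= (`|x| + `|y|) ^+ 2.
  by rewrite ler_sqr ?nnegrE ?ler_normD ?addr_ge0.
rewrite sqrrD !Hdot !dotE (dotC y x); lra.
Qed.

Lemma abs_dot_le_norm x y : `|dot x y| <= `|x| * `|y|.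
Proof.
rewrite ler_norml dot_le_norm lerNl -dotNl.
by rewrite (le_trans (dot_le_norm _ _))// normrN.
Qed.

(** The polarization identity reduces the continuity of the inner product to
    that of the norm. *)
Lemma cvg_dot {T} {F : set_system T} {FF : Filter F} (f g : T -> H) x y :
  f @ F --> x -> g @ F --> y -> dot (f t) (g t) @[t --> F] --> dot x y.
Proof.
move=> fx gy.
have pol u v : dot u v = (`|u + v| * `|u + v| - `|u - v| * `|u - v|) / 4.
  by rewrite -!expr2 !Hdot !dotE (dotC v u); field.
rewrite pol (funext (fun t => pol (f t) (g t))).
apply: cvgM; last exact: cvg_cst.
by apply: cvgB; apply: cvgM; apply: cvg_norm;
  [apply: cvgD..|apply: cvgB|apply: cvgB].
Qed.

(** The hypothesis has the form that the parallelogram law gives for a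
    minimizing sequence, [e n] being, up to a constant factor, the distance of
    the [n]-th value to the infimum. *)
Lemma cvgn_of_sqr_dist (x : nat -> H) (e : nat -> R) :
  e n @[n --> \oo] --> 0 ->
  (forall n k, `|x n - x k| ^+ 2 <= e n + e k) -> cvgn x.
Proof.
move=> e0 xe; apply/cauchy_cvgP; apply/cauchy_ballP => d d0; near_simpl.
have [N _ eN] : \forall n \near \oo, `|e n| < d ^+ 2 / 2.
  by apply: cvgr0_norm_lt => //; rewrite divr_gt0// exprn_gt0.
exists ([set n | N <= n], [set n | N <= n])%N; first by split; exists N.
move=> [n k] [/= /eN/ltr_normlW en /eN/ltr_normlW ek]; rewrite -ball_normE /=.
rewrite -(ltr_pXn2r (n := 2)) ?nnegrE ?(ltW d0)//.
apply: le_lt_trans (xe n k) _; lra.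
Qed.

(** A quadratically perturbed convex minimization problem has a solution in a
    Hilbert space without any recourse to weak compactness, because minimizing
    sequences are Cauchy.  The set [K] is the epigraph of the convex function;
    the conclusion is the first-order optimality condition at the minimizer of
    [t + (|x|^2 + |u|^2) / 2]. *)
Lemma exists_proximal_point (K : H -> H -> R -> Prop) (L : R) :
  (exists x u t, K x u t) ->
  (forall x u t x' u' t' a, 0 <= a <= 1 -> K x u t -> K x' u' t' ->
    K (x + a *: (x' - x)) (u + a *: (u' - u)) (t + a * (t' - t))) ->
  (forall (x u : nat -> H) (t : nat -> R) x' u' t',
    (forall n, K (x n) (u n) (t n)) ->
    x n @[n --> \oo] --> x' -> u n @[n --> \oo] --> u' ->
    t n @[n --> \oo] --> t' -> K x' u' t') ->
  (forall x u t, K x u t -> L <= t + (dot x x + dot u u) / 2) ->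
  exists x u t, K x u t /\
    forall x' u' t', K x' u' t' -> t <= t' + dot x (x' - x) + dot u (u' - u).
Proof.
move=> [x1 [u1 [t1 K1]]] Kconv Kclosed KL.
pose val (p : H * H * R) := p.2 + (dot p.1.1 p.1.1 + dot p.1.2 p.1.2) / 2.
pose E := [set val p | p in [set p | K p.1.1 p.1.2 p.2]].
have Einf : has_inf E.
  split; first by exists (val (x1, u1, t1)); exists (x1, u1, t1).
  by exists L => _ [[[a b] c] /= Kabc <-]; exact: KL.
have infE x u t : K x u t -> inf E <= t + (dot x x + dot u u) / 2.
  by move=> Kxu; apply: ge_inf; [case: Einf|exists (x, u, t)].
have /choice[p Hp] n : exists p : H * H * R,
    K p.1.1 p.1.2 p.2 /\ val p < inf E + harmonic n.
  have [_ [p Kp <-] vp] := inf_adherent (@harmonic_gt0 R n) Einf.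
  by exists p.
pose x n := (p n).1.1; pose u n := (p n).1.2; pose t n := (p n).2.
have Kp n : K (x n) (u n) (t n) by case: (Hp n).
have vp n : t n + (dot (x n) (x n) + dot (u n) (u n)) / 2 < inf E + harmonic n.
  by case: (Hp n).
(* Parallelogram law: the midpoint of two points of [K] is in [K], so its value
   is at least the infimum. *)
have par n k : dot (x n - x k) (x n - x k) + dot (u n - u k) (u n - u k) <=
    4 * harmonic n + 4 * harmonic k.
  have /infE : K (x n + 2^-1 *: (x k - x n)) (u n + 2^-1 *: (u k - u n))
                 (t n + 2^-1 * (t k - t n)).
    by apply: Kconv => //; lra.
  move: (vp n) (vp k); rewrite !dotE (dotC (x k) (x n)) (dotC (u k) (u n)).
  set hn := harmonic n; set hk := harmonic k; lra.
have e0 : (4 * @harmonic R n) @[n --> \oo] --> (0 : R).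
  rewrite -[X in _ --> X](mulr0 (4 : R)).
  by apply: cvgM; [exact: cvg_cst|exact: cvg_harmonic].
have xcvg : cvgn x.
  apply: (cvgn_of_sqr_dist e0) => n k; rewrite Hdot.
  by apply: le_trans (par n k); rewrite lerDl dot_ge0.
have ucvg : cvgn u.
  apply: (cvgn_of_sqr_dist e0) => n k; rewrite Hdot.
  by apply: le_trans (par n k); rewrite lerDr dot_ge0.
set x0 := limn x; set u0 := limn u.
pose t0 := inf E - (dot x0 x0 + dot u0 u0) / 2.
have Qcvg : ((dot (x n) (x n) + dot (u n) (u n)) / 2) @[n --> \oo] -->
    (dot x0 x0 + dot u0 u0) / 2.
  by apply: cvgM; [apply: cvgD; exact: cvg_dot|exact: cvg_cst].
have tcvg : t n @[n --> \oo] --> t0.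
  apply: (@squeeze_cvgr _ _ _ _
    (fun n => inf E - (dot (x n) (x n) + dot (u n) (u n)) / 2)
    (fun n => inf E + harmonic n - (dot (x n) (x n) + dot (u n) (u n)) / 2)).
  - apply: nearW => n; move: (vp n) (infE _ _ _ (Kp n)).
    set h := harmonic n; lra.
  - by apply: cvgB => //; exact: cvg_cst.
  - apply: cvgB => //; rewrite -[X in _ --> X]addr0.
    by apply: cvgD; [exact: cvg_cst|exact: cvg_harmonic].
have K0 : K x0 u0 t0 by exact: Kclosed Kp xcvg ucvg tcvg.
exists x0, u0, t0; split=> // x' u' t' K'.
set Q := (dot (x' - x0) (x' - x0) + dot (u' - u0) (u' - u0)) / 2.
set c := t' - t0 + dot x0 (x' - x0) + dot u0 (u' - u0).
have Q0 : 0 <= Q by rewrite divr_ge0// addr_ge0 ?dot_ge0.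
have first_order a : 0 < a <= 1 -> 0 <= c + a * Q.
  move=> /andP[a0 a1].
  have /infE : K (x0 + a *: (x' - x0)) (u0 + a *: (u' - u0))
                 (t0 + a * (t' - t0)).
    by apply: Kconv => //; rewrite (ltW a0) a1.
  move: (x' - x0) (u' - u0) @Q @c {Q0} => dx du /=.
  rewrite !dotE (dotC dx x0) (dotC du u0) /t0 => h.
  rewrite -(pmulr_rge0 _ a0); lra.
(* If [c < 0], the value [a = - c / (Q + 1 - c)] lies in [0, 1] and makes the
   right-hand side of [first_order] negative. *)
suff : 0 <= c by rewrite /c; lra.
rewrite leNgt; apply/negP => c0.
have d0 : 0 < Q + 1 - c by lra.
have := first_order (- c / (Q + 1 - c)).
have -> : c + - c / (Q + 1 - c) * Q = c * (1 - c) / (Q + 1 - c).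
  by field; apply/eqP => h; move: d0; rewrite h ltxx.
rewrite ler_pdivrMr// mul1r divr_gt0 ?oppr_gt0//= => /(_ ltac:(lra)).
rewrite pmulr_lge0 ?invr_gt0// nmulr_rge0//; lra.
Qed.

End InnerProduct.

(** * Riesz's theorem, Minty's theorem and resolvents *)

Section MaximallyMonotone.
Context {R : realType} {H : completeNormedModType R}.
Variable dot : {dot H for idfun}.
Hypothesis Hdot : induces_norm dot.
Implicit Types (M T : H -> set H) (x y u v w : H) (a c : R).

Let dotC := dotC dot.
Let dotE := dotE dot.

(** Riesz's theorem: the representative of [f] is the minimizer of
    [|x|^2 / 2 - f x].  The second component of the minimization problem is
    frozen at [0]. *)
Lemma riesz_representation (f : H -> R) (m : R) :
  (forall a x y, f (a *: x + y) = a * f x + f y) ->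
  (forall x, `|f x| <= m * `|x|) ->
  exists z, forall x, f x = dot z x.
Proof.
move=> flin fbd.
have f0 : f 0 = 0.
  have := flin 1 0 0; rewrite scaler0 addr0 mul1r => h.
  by apply: (addrI (f 0)); rewrite addr0 -h.
have fD x y : f (x + y) = f x + f y.
  by have := flin 1 x y; rewrite scale1r mul1r.
have fZ a x : f (a *: x) = a * f x by have := flin a x 0; rewrite f0 !addr0.
have fN x : f (- x) = - f x by rewrite -scaleN1r fZ mulN1r.
pose K (x u : H) (t : R) := u = 0 /\ t = - f x.
have [||||z [u [t [[-> ->] opt]]]] :=
  @exists_proximal_point _ _ _ Hdot K (- m ^+ 2 / 2).
- by exists 0, 0, (- f 0).
- move=> x u t x' u' t' a _ [-> ->] [-> ->]; split.
    by rewrite subrr scaler0 addr0.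
  by rewrite fD fZ fD fN; ring.
- move=> x u t x' u' t' Kn xx' uu' tt'; split.
    apply: (cvg_unique (@norm_hausdorff _ _) uu').
    rewrite (_ : u = fun=> 0); first exact: cvg_cst.
    by apply/funext => n; case: (Kn n).
  apply: (cvg_unique (@norm_hausdorff _ _) tt').
  rewrite (_ : t = fun n => - f (x n)); last by apply/funext => n; case: (Kn n).
  apply: cvgN; apply/subr_cvg0.
  apply: (@squeeze_cvgr _ _ _ _
    (fun n => - (m * `|x n - x'|)) (fun n => m * `|x n - x'|)).
  + by apply: nearW => n; rewrite -ler_norml -fN -fD.
  + rewrite -[X in _ --> X]oppr0 -[X in _ --> - X](mulr0 m); apply: cvgN.
    by apply: cvgM; [exact: cvg_cst|apply/norm_cvg0P/subr_cvg0].
  + rewrite -[X in _ --> X](mulr0 m).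
    by apply: cvgM; [exact: cvg_cst|apply/norm_cvg0P/subr_cvg0].
- move=> x u t [-> ->]; rewrite (dot0l dot) addr0 -Hdot.
  have := fbd x; rewrite ler_norml => /andP[_ h].
  have := sqr_ge0 (`|x| - m); lra.
exists z => x.
have le y : f y <= dot z y.
  have := opt (z + y) 0 (- f (z + y)) (conj erefl erefl).
  by rewrite fD [z + y]addrC addrK subrr (dot0l dot); lra.
apply/eqP; rewrite eq_le le /=.
by have := le (- x); rewrite fN (dotNr dot) lerN2.
Qed.

(** The working form of maximality: otherwise adding [(x, u)] to the graph would
    give a proper monotone extension. *)
Lemma maximally_monotone_related M x u : maximally_monotone_op dot M ->
  (forall y v, M y v -> 0 <= dot (x - y) (u - v)) -> M x u.
Proof.
move=> [Mmon Mmax] rel.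
pose N y := M y `|` [set v | y = x /\ v = u].
have -> : M x u = graph N (x, u) :> Prop.
  rewrite (Mmax N)//; last by move=> [y v]; left.
  move=> y v y' v'; rewrite /graph /=.
  case=> [My|[-> ->]]; case=> [My'|[-> ->]].
  - exact: Mmon My My'.
  - rewrite -[y - x]opprB -[v - u]opprB (dotNl dot) (dotNr dot) opprK.
    exact: rel.
  - exact: rel.
  - by rewrite !subrr (dot0l dot).
by right.
Qed.

(** Minty's theorem at the origin.  The convex function minimized is the
    Fitzpatrick function of [M], which dominates the duality product
    [dot x u] because [M] is maximal, so that the minimum of
    [t + (|x|^2 + |u|^2) / 2] is nonnegative.  The optimality condition then
    says that [(- u, - x)] is monotonically related to the graph of [M], hence
    belongs to it; at that very point the condition reads [|x + u|^2 <= 0]. *)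
Lemma minty_zero M : monotone_op dot M ->
  (forall x u, (forall y v, M y v -> 0 <= dot (x - y) (u - v)) -> M x u) ->
  exists x, M x (- x).
Proof.
move=> Mmon Mrel.
have [x1 [u1 M1]] : exists x u, M x u.
  apply: contrapT => none; case: (none); exists 0, 0; apply: Mrel => y v Myv.
  by case: none; exists y, v.
pose K x u (t : R) := forall y v, M y v -> dot x v + dot y u - dot y v <= t.
have MK x u : M x u -> K x u (dot x u).
  by move=> Mxu y v Myv; have := Mmon _ _ _ _ Mxu Myv; rewrite !dotE; lra.
have Kge x u t : K x u t -> dot x u <= t.
  move=> Kxu; rewrite leNgt; apply/negP => lt.
  have /Kxu : M x u by apply: Mrel => y v /Kxu; rewrite !dotE; lra.
  by lra.
have [||||x [u [t [/Kge Kxu opt]]]] := @exists_proximal_point _ _ _ Hdot K 0.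
- by exists x1, u1, (dot x1 u1); exact: MK.
- move=> x u t x' u' t' a /andP[a0 a1] Kx Kx' y v Myv.
  have := ler_wpM2l (_ : 0 <= 1 - a) (Kx y v Myv).
  rewrite subr_ge0 => /(_ a1) h1; have := ler_wpM2l a0 (Kx' y v Myv).
  rewrite !dotE; lra.
- move=> x u t x' u' t' Kn xx' uu' tt' y v Myv.
  have lhs : dot (x n) v + dot y (u n) - dot y v @[n --> \oo] -->
      dot x' v + dot y u' - dot y v.
    apply: cvgB; last exact: cvg_cst.
    by apply: cvgD; apply: (cvg_dot Hdot) => //; exact: cvg_cst.
  by apply: (ler_cvg_to lhs tt'); apply: nearW => n; exact: Kn.
- move=> x u t /Kge h; have := dot_ge0 Hdot (x + u).
  by rewrite !dotE (dotC u x); lra.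
have Mux : M (- u) (- x).
  apply: Mrel => y v Myv; have := opt _ _ _ (MK _ _ Myv).
  have := dot_ge0 Hdot (x + u).
  by rewrite !dotE (dotC u x) (dotC y x); lra.
have : dot (x + u) (x + u) <= 0.
  have := opt _ _ _ (MK _ _ Mux); rewrite !dotE (dotC u x); lra.
move=> /(dot_eq0 Hdot)/eqP; rewrite addr_eq0 => /eqP xu.
by exists (- u); rewrite -{2}xu.
Qed.

(** The case of a general point [w] and scale [c] is that of the operator
    [x => c M x - w], which is again maximally monotone. *)
Lemma minty M c w : maximally_monotone_op dot M -> 0 < c ->
  exists x, M x (c^-1 *: (w - x)).
Proof.
move=> Mmax c0; have cV0 : 0 < c^-1 by rewrite invr_gt0.
have diff u v : u - v = c *: (c^-1 *: (w + u) - c^-1 *: (w + v)).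
  rewrite -scalerBr scalerA divff ?gt_eqF// scale1r.
  by rewrite opprD addrACA subrr add0r.
apply: (@minty_zero (fun x => [set u | M x (c^-1 *: (w + u))])).
- move=> x u y v Mxu Myv; rewrite (diff u v) (dotZr dot) pmulr_rge0//.
  by apply: (Mmax.1 x (c^-1 *: (w + u)) y (c^-1 *: (w + v)));
    [exact: Mxu|exact: Myv].
- move=> x u rel; apply: (maximally_monotone_related Mmax) => y v Myv.
  have vE : v = c^-1 *: (w + (c *: v - w)).
    by rewrite addrCA subrr addr0 scalerA mulVf ?gt_eqF// scale1r.
  have := rel y (c *: v - w); rewrite /= -vE => /(_ Myv).
  by rewrite (diff u (c *: v - w)) -vE (dotZr dot) pmulr_rge0.
Qed.

Lemma resolvent_scaleP M c y (x := resolvent (op_scale c M) y) :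
  maximally_monotone_op dot M -> 0 < c -> M x (c^-1 *: (y - x)).
Proof.
move=> Mmax c0.
have : op_inv (op_add (op_fun idfun) (op_scale c M)) y x.
  apply: xgetPex; have [z Mz] := minty y Mmax c0.
  exists z; exists z => //; exists (y - z); last by rewrite addrC subrK.
  exists (c^-1 *: (y - z)) => //.
  by rewrite scalerA divff ?gt_eqF// scale1r.
move=> [_ -> [_ [v Mv <-] yE]].
have -> : y - x = c *: v by rewrite -yE addrC addKr.
by rewrite scalerA mulVf ?gt_eqF// scale1r.
Qed.

Lemma resolvent_nonexpansive M c : maximally_monotone_op dot M -> 0 < c ->
  forall y z, `|resolvent (op_scale c M) y - resolvent (op_scale c M) z|
              <= `|y - z|.
Proof.
move=> Mmax c0 y z; set j := resolvent _.
have := Mmax.1 _ _ _ _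
  (resolvent_scaleP y Mmax c0) (resolvent_scaleP z Mmax c0).
rewrite -/j -scalerBr (dotZr dot) pmulr_rge0 ?invr_gt0//.
have -> : y - j y - (z - j z) = (y - z) - (j y - j z).
  rewrite !opprB !addrA -!addrA; congr (_ + _).
  by rewrite addrCA [RHS]addrCA; congr (_ + _); rewrite addrC.
have := dot_le_norm Hdot (j y - j z) (y - z).
move: (j y - j z) (y - z) => d e h1; rewrite dotDr (dotNr dot) -Hdot => h2.
have [->//|d0] := eqVneq d 0; first by rewrite normr0.
have : `|d| * `|d| <= `|d| * `|e| by rewrite -expr2; lra.
by rewrite ler_pM2l// normr_gt0.
Qed.

(** This is the maximality of [T + D] at the point [(z, 0)].  The hypothesis is
    tested at the solution of [v = J_(c T) (z - c D v)], which exists because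
    the right-hand side is a contraction when [c] is less than the inverse of
    the Lipschitz constant of [D]; there it reads [- |v - z|^2 / c >= 0], so that
    [v = z] and the inclusion defining [v] is the conclusion. *)
Lemma related_zero_add_lipschitz T (D : H -> H) (eta : R) z :
  maximally_monotone_op dot T -> 0 < eta -> eta^-1.-lipschitz D ->
  (forall v t, T v t -> 0 <= dot (v - z) (t + D v)) -> T z (- D z).
Proof.
move=> Tmax eta0 Dlip rel; pose c := eta / 2.
have c0 : 0 < c by rewrite divr_gt0.
pose g v := resolvent (op_scale c T) (z - c *: D v).
have gf : {homo g : x / [set: H] x >-> [set: H] x} by [].
have ctr : is_contraction (mkfun gf).
  have h0 : 0 <= 2^-1 :> R by [].
  exists (NngNum h0); split => /=; first lra.
  move=> [v w] _ /=; apply: le_trans (resolvent_nonexpansive Tmax c0 _ _) _.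
  rewrite opprD opprK addrACA subrr add0r addrC -scalerBr normrZ (gtr0_norm c0).
  rewrite distrC; have /= := Dlip (v, w) (conj I I).
  rewrite -(ler_pM2l c0) => /le_trans; apply.
  rewrite mulrA ler_wpM2r// /c mulrAC divff ?gt_eqF//; lra.
have [v _ vg] := banach_fixed_point ctr closedT (ex_intro _ 0 I).
rewrite /= in vg.
have Tv := resolvent_scaleP (z - c *: D v) Tmax c0.
have {}vg : resolvent (op_scale c T) (z - c *: D v) = v by rewrite {2}vg.
rewrite vg in Tv.
have tE : c^-1 *: (z - c *: D v - v) = - (c^-1 *: (v - z)) - D v.
  rewrite addrAC scalerBr scalerA mulVf ?gt_eqF// scale1r; congr (_ - _).
  by rewrite -scalerN opprB.
have := rel _ _ Tv; rewrite tE subrK (dotNr dot) (dotZr dot) oppr_ge0.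
rewrite pmulr_rle0 ?invr_gt0// => /(dot_eq0 Hdot)/eqP.
rewrite subr_eq0 => /eqP vz.
by move: Tv; rewrite tE vz subrr scaler0 oppr0 add0r.
Qed.

End MaximallyMonotone.

(** * Weak limits along ultrafilters *)

(** A cluster point of [f] along [U], given by the compactness of a bounded
    closed interval, is a limit because [U] is an ultrafilter. *)
Lemma ultra_bounded_cvg {T : Type} {R : realType} (U : set_system T)
    {UU : UltraFilter U} (f : T -> R) (m : R) :
  (forall t, `|f t| <= m) -> exists l : R, f t @[t --> U] --> l.
Proof.
move=> fm; have FU : ProperFilter (fmap f U) by exact: fmap_proper_filter.
have [] := @segment_compact R (- m) m (fmap f U) FU.
  by apply: (@filterE _ U) => t /=; rewrite in_itv /= -ler_norml.
move=> l [_ lcl]; exists l => V Vl.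
have [//|nV] := in_ultra_setVsetC (f @^-1` V) UU.
have [x [nVx Vx]] := lcl (~` V) V nV Vl.
by [].
Qed.

(** If [P] were not in [F], then [F] together with the complement of [P] would
    generate a proper filter, contained in some ultrafilter. *)
Lemma filter_of_ultra {T : Type} (F : set_system T) {FF : ProperFilter F}
    (P : set T) :
  (forall U, UltraFilter U -> F `<=` U -> U P) -> F P.
Proof.
move=> ultraP; apply: contrapT => nFP.
have GF : ProperFilter (within (~` P) F).
  refine (Build_ProperFilter_ex _ (within_filter _ _)).
  move=> Q; rewrite /within /= => FQ; apply: contrapT => noQ; apply: nFP.
  apply: filterS FQ => x /= h; apply: contrapT => nPx.
  by apply: noQ; exists x; exact: h.
have [U [UU GU]] := ultraFilterLemma GF.
have FU : F `<=` U.
  by move=> Q FQ; apply: GU; rewrite /within /=; apply: filterS FQ => x Qx _.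
have UnP : U (~` P) by apply: GU; exact: withinT.
by have [x [Px nPx]] := filter_ex (filterI (ultraP U UU FU) UnP).
Qed.

Section WeakConvergence.
Context {R : realType} {H : completeNormedModType R}.
Variable dot : {dot H for idfun}.
Hypothesis Hdot : induces_norm dot.
Implicit Types (u l : H) (z : nat -> H).

Definition weak_limit_along (F : set_system nat) z l :=
  forall u, dot (z n) u @[n --> F] --> dot l u.

(** Weak compactness of balls: along an ultrafilter the scalar products
    converge to a bounded linear functional, which has a Riesz
    representative. *)
Lemma weak_limit_ultra (U : set_system nat) {UU : UltraFilter U} z (m : R) :
  (forall n, `|z n| <= m) -> exists l, weak_limit_along U z l.
Proof.
move=> zm.
have zu n u : `|dot (z n) u| <= m * `|u|.
  by apply: le_trans (abs_dot_le_norm Hdot _ _) _; rewrite ler_wpM2r.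
have /choice[f Hf] u : exists l : R, dot (z n) u @[n --> U] --> l.
  by apply: (@ultra_bounded_cvg _ _ _ _ _ (m * `|u|)) => n.
have [a u v|u|l fl] := @riesz_representation _ _ _ Hdot f m.
- apply: (cvg_unique (@norm_hausdorff _ _) (Hf (a *: u + v))).
  have -> : (fun n => dot (z n) (a *: u + v)) =
      (fun n => a * dot (z n) u + dot (z n) v).
    by apply/funext => n; rewrite (dotDr dot) (dotZr dot).
  by apply: cvgD => //; apply: cvgM => //; exact: cvg_cst.
- apply: cvgr_to_le (cvg_norm (Hf u)) _; apply: filterE => n; exact: zu.
by exists l => u; rewrite -fl; exact: Hf.
Qed.

(** Opial's principle: two weak cluster points [a] and [b] in [S] satisfy
    [dot a (a - b) = lim dot (z n) (a - b) = dot b (a - b)], hence coincide,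
    and a bounded sequence with a unique weak cluster point converges weakly. *)
Lemma opial z (S : set H) (m : R) :
  (forall n, `|z n| <= m) ->
  (forall U l, UltraFilter U -> \oo `<=` U -> weak_limit_along U z l -> S l) ->
  (forall a b, S a -> S b -> cvgn (fun n => dot (z n) (a - b))) ->
  exists2 l, S l & weakly_converges dot z l.
Proof.
move=> zm clS cvgS.
have [U0 [UU0 oU0]] := ultraFilterLemma (@eventually_filter).
have [l0 Hl0] := weak_limit_ultra zm.
exists l0; first exact: clS Hl0.
move=> u V Vl0.
apply: (@filter_of_ultra _ _ _ ((fun n => dot (z n) u) @^-1` V)) => U UU oU.
have [l Hl] := @weak_limit_ultra U _ _ _ zm.
suff l0l : l0 = l by rewrite l0l in Vl0; exact: Hl Vl0.
have [c Hc] : exists c : R, dot (z n) (l0 - l) @[n --> \oo] --> c.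
  by apply/cvg_ex; apply: cvgS; [exact: clS Hl0|exact: clS Hl].
have eqc W k : UltraFilter W -> \oo `<=` W -> weak_limit_along W z k ->
    dot k (l0 - l) = c.
  move=> UW oW Hk; apply: (cvg_unique (@norm_hausdorff _ _) (Hk _)).
  exact: cvg_trans (cvg_app _ oW) Hc.
apply/eqP; rewrite -subr_eq0; apply/eqP; apply: (dot_eq0 Hdot).
rewrite (dotDl dot) (dotNl dot) (eqc U0 l0)// (eqc U l)//; lra.
Qed.

End WeakConvergence.

(** * Real sequences and series *)

Section Sequences.
Context {R : realType}.
Implicit Types (a e lambda c : nat -> R).

(** The sequence [a n - \sum_(k < n) e k] is nonincreasing and bounded below,
    and the sums converge. *)
Lemma quasi_fejer_cvg a e (m : R) N :
  (forall n, (N <= n)%N -> 0 <= a n) -> (forall n, (N <= n)%N -> 0 <= e n) ->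
  (forall n, (N <= n)%N -> a n.+1 <= a n + e n) ->
  (forall n, \sum_(N <= k < n) e k <= m) -> cvgn a.
Proof.
move=> a0 e0 ae em.
pose s n := \sum_(N <= k < n + N) e k.
have sS n : s n.+1 = s n + e (n + N)%N.
  by rewrite /s addSn big_nat_recr//= leq_addl.
have scvg : cvgn s.
  apply: nondecreasing_is_cvgn.
    by apply/nondecreasing_seqP => n; rewrite sS lerDl e0 ?leq_addl.
  by exists m => _ [n _ <-]; exact: em.
have bcvg : cvgn (fun n => a (n + N)%N - s n).
  apply: nonincreasing_is_cvgn.
    apply/nonincreasing_seqP => n; rewrite sS addSn.
    have := ae (n + N)%N (leq_addl _ _); lra.
  exists (- m) => _ [n _ <-].
  by have := em (n + N)%N; have := a0 (n + N)%N (leq_addl _ _); rewrite /s; lra.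
have : cvgn (fun n => a (n + N)%N).
  have -> : (fun n => a (n + N)%N) = (fun n => (a (n + N)%N - s n) + s n).
    by apply/funext => n; rewrite subrK.
  exact: is_cvgD.
by case/cvg_ex => l; rewrite cvg_shiftn => al; apply/cvg_ex; exists l.
Qed.

(** The terms of index at most [N] contribute a constant [K], which the division
    by the divergent sum of the weights makes negligible; the other terms are
    already close to [l]. *)
Lemma weighted_mean_cvg lambda c (l : R)
    (tau := fun n => \sum_(1 <= k < n.+1) lambda k) :
  (forall n, (1 <= n)%N -> 0 < lambda n) ->
  tau n @[n --> \oo] --> +oo -> c n @[n --> \oo] --> l ->
  (tau n)^-1 * (\sum_(1 <= k < n.+1) lambda k * c k) @[n --> \oo] --> l.
Proof.
move=> lam0 tauoo cl; apply/cvgrPdist_le => e e0.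
have e20 : 0 < e / 2 by rewrite divr_gt0.
have [N _ cN] : \forall n \near \oo, `|l - c n| <= e / 2.
  by move/cvgrPdist_le : cl; apply.
pose K := \sum_(1 <= k < N.+1) lambda k * `|l - c k|.
near=> n.
have tau0 : 0 < tau n by near: n; move/cvgryPgt : tauoo; apply.
have tauK : K / (e / 2) <= tau n by near: n; move/cvgryPge : tauoo; apply.
have Nn : (N <= n)%N by near: n; exists N.
have -> : l - (tau n)^-1 * (\sum_(1 <= k < n.+1) lambda k * c k) =
    (tau n)^-1 * (\sum_(1 <= k < n.+1) lambda k * (l - c k)).
  under [in RHS]eq_bigr do rewrite mulrBr.
  by rewrite sumrB -mulr_suml mulrBr mulrA mulVf ?gt_eqF// mul1r.
rewrite normrM (gtr0_norm (x := _^-1)) ?invr_gt0// mulrC ler_pdivrMr//.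
apply: le_trans (ler_norm_sum _ _ _) _.
have -> : \sum_(1 <= k < n.+1) `|lambda k * (l - c k)| =
    \sum_(1 <= k < n.+1) lambda k * `|l - c k|.
  by apply: eq_big_nat => k /andP[k1 _]; rewrite normrM gtr0_norm ?lam0.
rewrite (@big_cat_nat _ _ _ N.+1)//= -/K.
have : \sum_(N.+1 <= k < n.+1) lambda k * `|l - c k| <= e / 2 * tau n.
  rewrite /tau (@big_cat_nat _ _ _ N.+1 1%N n.+1)//= mulrDr.
  rewrite ler_wpDl//.
    rewrite mulr_ge0 ?(ltW e20)// big_nat sumr_ge0// => k /andP[k1 _].
    by rewrite ltW ?lam0.
  rewrite mulr_sumr ler_sum_nat// => k /andP[k1 _].
  rewrite mulrC ler_wpM2r ?(ltW (lam0 _ _)) ?(leq_trans _ k1)//.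
  by apply: cN; rewrite /= ltnW.
by move: tauK; rewrite ler_pdivrMr//; lra.
Unshelve. all: by end_near. Qed.

(** Convergent nonnegative series of extended reals are brought back to real
    series with bounded partial sums. *)
Lemma nneseries_bounded_sums (a : nat -> \bar R) :
  (forall n, (1 <= n)%N -> (0 <= a n)%E) ->
  (\sum_(1 <= n <oo) a n < +oo)%E ->
  (forall n, (1 <= n)%N -> a n = (fine (a n))%:E) /\
  exists m, forall n, \sum_(1 <= k < n) fine (a k) <= m.
Proof.
move=> a0 aoo.
have sum_lt n : (\sum_(1 <= k < n) a k < +oo)%E.
  by apply: le_lt_trans (nneseries_lim_ge _ _) aoo => k k1 _; exact: a0.
have afin n : (1 <= n)%N -> a n = (fine (a n))%:E.
  move=> n1; rewrite fineK// ge0_fin_numE ?a0//.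
  apply: le_lt_trans (sum_lt n.+1); rewrite big_nat_recr//=.
  by rewrite leeDr// big_nat sume_ge0// => k /andP[k1 _]; exact: a0.
split=> //; exists (fine (\sum_(1 <= n <oo) a n)%E) => n.
rewrite -lee_fin fineK; last first.
  rewrite ge0_fin_numE//; apply: le_trans (nneseries_lim_ge 1%N _).
    by rewrite big_geq.
  by move=> k k1 _; exact: a0.
rewrite -sumEFin (_ : (\sum_(1 <= k < n) (fine (a k))%:E)%E =
                      (\sum_(1 <= k < n) a k)%E).
  by apply: nneseries_lim_ge => k k1 _; exact: a0.
by apply: eq_big_nat => k /andP[k1 _]; rewrite -afin.
Qed.

Lemma ell2_cvg0 lambda : ell 2 lambda ->
  (lambda n ^+ 2) @[n --> \oo] --> 0 /\
  exists m, forall n, \sum_(1 <= k < n) lambda k ^+ 2 <= m.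
Proof.
move=> /nneseries_bounded_sums [n _|_ [m Hm]].
  by rewrite lee_fin exprn_ge0.
have {}Hm n : \sum_(1 <= k < n) lambda k ^+ 2 <= m.
  apply: le_trans (Hm n); apply: ler_sum_nat => k _ /=.
  by rewrite real_normK ?num_real.
split; last by exists m.
rewrite -cvg_shiftS; apply: cvg_series_cvg_0.
apply: nondecreasing_is_cvgn.
  apply/nondecreasing_seqP => n.
  by rewrite !seriesEnat/= big_nat_recr//= lerDl sqr_ge0.
exists m => _ [n _ <-]; rewrite seriesEnat/=.
by have := Hm n.+1; rewrite big_add1.
Qed.

Lemma not_ell1_cvg_pinfty lambda : (forall n, (1 <= n)%N -> 0 < lambda n) ->
  ~ ell 1 lambda -> (\sum_(1 <= k < n.+1) lambda k) @[n --> \oo] --> +oo.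
Proof.
move=> lam0 nell; apply/cvgryPge => A.
have [N AN] : exists N, A <= \sum_(1 <= k < N.+1) lambda k.
  apply: contrapT => bd; apply: nell.
  apply: (@le_lt_trans _ _ A%:E); last exact: ltry.
  apply: lime_le.
    by apply: is_cvg_nneseries => n _ _; rewrite lee_fin exprn_ge0.
  exists 1%N => // -[//|n] _.
  rewrite sumEFin lee_fin leNgt; apply/negP => lt; apply: bd; exists n.
  apply: le_trans (ltW lt) _; apply: ler_sum_nat => k /andP[k1 _].
  by rewrite expr1 gtr0_norm ?lam0.
exists N => // n /= Nn; apply: le_trans AN _.
rewrite (@big_cat_nat _ _ _ N.+1 1%N n.+1)//= lerDl big_nat sumr_ge0//.
by move=> k /andP[Nk _]; rewrite ltW ?lam0 ?(leq_trans _ Nk).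
Qed.

Lemma ler_sum_tail (f : nat -> R) m N n : (m <= N)%N ->
  (forall k, (m <= k)%N -> 0 <= f k) ->
  \sum_(N <= k < n) f k <= \sum_(m <= k < n) f k.
Proof.
move=> mN f0; have sum0 j : 0 <= \sum_(m <= k < j) f k.
  by rewrite big_nat sumr_ge0// => k /andP[/f0].
have [Nn|nN] := leqP N n; last by rewrite [leLHS]big_geq ?(ltnW nN).
by rewrite [leRHS](@big_cat_nat _ _ _ N)//= lerDr.
Qed.

End Sequences.

(** * Ergodic convergence of quasi-Fejer sequences *)

Section Ergodic.
Context {R : realType} {H : completeNormedModType R}.
Variable dot : {dot H for idfun}.
Hypothesis Hdot : induces_norm dot.
Implicit Types (T : H -> set H) (u v w t g : H) (x : nat -> H)
  (lambda : nat -> R).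

Let dotC := dotC dot.
Let dotE := dotE dot.

Definition ergodic_mean lambda x : nat -> H := fun n =>
  (\sum_(1 <= k < n.+1) lambda k)^-1 *: \sum_(1 <= k < n.+1) lambda k *: x k.

Lemma dot_ergodic_mean lambda x n u : dot (ergodic_mean lambda x n) u =
  (\sum_(1 <= k < n.+1) lambda k)^-1 *
  \sum_(1 <= k < n.+1) lambda k * dot (x k) u.
Proof.
rewrite (dotZl dot); congr (_ * _).
rewrite (big_morph (dot^~ u) (fun a b => dotDl dot a b u) (dot0l dot u)).
by apply: eq_bigr => k _; rewrite (dotZl dot).
Qed.

Lemma ergodic_mean_bounded lambda x (m : R) :
  (forall n, (1 <= n)%N -> 0 < lambda n) -> (forall n, `|x n| <= m) ->
  forall n, `|ergodic_mean lambda x n| <= m.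
Proof.
move=> lam0 xm [|n].
  rewrite /ergodic_mean !big_nil scaler0 normr0.
  by apply: le_trans (xm 0%N).
have tau0 : 0 < \sum_(1 <= k < n.+2) lambda k.
  rewrite big_nat_recr//= ltr_wpDl ?lam0// big_nat sumr_ge0// => k /andP[k1 _].
  by rewrite ltW ?lam0.
rewrite /ergodic_mean normrZ gtr0_norm ?invr_gt0// mulrC ler_pdivrMr//.
apply: le_trans (ler_norm_sum _ _ _) _.
rewrite mulr_sumr; apply: ler_sum_nat => k /andP[k1 _].
by rewrite normrZ gtr0_norm ?lam0// mulrC ler_wpM2r// ltW ?lam0.
Qed.

(** Here [g] stands for a value at [u] of the monotone operator whose zeros are
    sought.  For [g = 0] this is quasi-Fejer monotonicity relative to [u]. *)
Definition quasi_fejer_pair lambda x u g : Prop :=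
  exists N e (m : R), [/\ (1 <= N)%N,
    forall n, (N <= n)%N -> 0 <= e n,
    forall n, (N <= n)%N -> dot (x n.+1 - u) (x n.+1 - u) <=
      dot (x n - u) (x n - u) + 2 * lambda n * dot g (u - x n) + e n &
    forall n, \sum_(N <= k < n) e k <= m].

Lemma quasi_fejer_pair_cvg lambda x u :
  quasi_fejer_pair lambda x u 0 -> cvgn (fun n => dot (x n - u) (x n - u)).
Proof.
move=> [N [e [m [_ e0 xe em]]]].
apply: (quasi_fejer_cvg (N := N) (e := e) (m := m)) => // n Nn.
  exact: dot_ge0.
by have := xe n Nn; rewrite (dot0l dot) mulr0 addr0.
Qed.

(** Summing the inequalities bounds [\sum_k lambda_k <g, x_k - u>], so that
    division by the divergent sum of the weights leaves a nonpositive limit. *)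
Lemma quasi_fejer_pair_cluster lambda x u g (U : set_system nat) l :
  (\sum_(1 <= k < n.+1) lambda k) @[n --> \oo] --> +oo ->
  quasi_fejer_pair lambda x u g ->
  UltraFilter U -> \oo `<=` U ->
  weak_limit_along dot U (ergodic_mean lambda x) l ->
  0 <= dot (u - l) g.
Proof.
move=> tauoo [N [e [m [N1 e0 xe em]]]] UU oU zl.
pose tau n := \sum_(1 <= k < n.+1) lambda k.
have telescope n : (N <= n)%N ->
    2 * \sum_(N <= k < n) lambda k * dot (x k - u) g <=
    dot (x N - u) (x N - u) - dot (x n - u) (x n - u) + \sum_(N <= k < n) e k.
  elim: n => [|n IH].
    by rewrite leqn0 => /eqP N0; rewrite N0 in N1.
  rewrite leq_eqVlt => /predU1P[<-|Nn].
    by rewrite !big_geq// subrr mulr0 addr0.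
  have {}IH := IH Nn; rewrite !big_nat_recr//=.
  have := xe n Nn; rewrite -(opprB (x n) u) (dotNr dot) (dotC g); lra.
pose K := \sum_(1 <= k < N) lambda k * dot (x k - u) g +
  (dot (x N - u) (x N - u) + m) / 2.
have meanK : \forall n \near \oo,
    dot (ergodic_mean lambda x n) g - dot u g <= K * (tau n)^-1.
  have /cvgryPgt/(_ 0) tau0 := tauoo.
  near=> n.
  have tn0 : 0 < tau n by near: n.
  have Nn : (N <= n)%N by near: n; exists N.
  rewrite dot_ergodic_mean -/(tau n) ler_pdivlMr// mulrBl.
  rewrite mulrAC mulVf ?gt_eqF// mul1r mulrC /tau mulr_suml -sumrB.
  under eq_bigr do rewrite -mulrBr -(dotNl dot) -(dotDl dot).
  rewrite (@big_cat_nat _ _ _ N)//= ?leqW// lerD2l.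
  have := telescope n.+1 (leqW Nn); have := em n.+1.
  have := dot_ge0 Hdot (x n.+1 - u); lra.
have tauV : (tau n)^-1 @[n --> \oo] --> 0.
  apply/gtr0_cvgV0 => //.
  by near=> n; near: n; move/cvgryPgt : tauoo; apply.
have lhs : dot (ergodic_mean lambda x n) g - dot u g @[n --> U] -->
    dot l g - dot u g.
  by apply: cvgB; [exact: zl|exact: cvg_cst].
have rhs : K * (tau n)^-1 @[n --> U] --> K * 0.
  by apply: cvgM; [exact: cvg_cst|exact: cvg_trans (cvg_app _ oU) tauV].
have PU : ProperFilter U := @ultra_proper _ _ UU.
have : dot l g - dot u g <= K * 0 by exact: (ler_cvg_to lhs rhs (oU _ meanK)).
by rewrite mulr0 (dotDl dot) (dotNl dot); lra.
Unshelve. all: by end_near. Qed.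

(** The Opial-Passty argument.  For two zeros [a] and [b] the polarization
    identity turns the convergence of [|x n - a|^2] and [|x n - b|^2] into that
    of [<x n, a - b>], to whose limit the weighted means converge too. *)
Lemma ergodic_weak_cvg T (D : H -> H) (eta : R) lambda x :
  maximally_monotone_op dot T -> 0 < eta -> eta^-1.-lipschitz D ->
  (forall n, (1 <= n)%N -> 0 < lambda n) ->
  (\sum_(1 <= k < n.+1) lambda k) @[n --> \oo] --> +oo ->
  (forall u t, T u t -> quasi_fejer_pair lambda x u (t + D u)) ->
  (exists u, T u (- D u)) ->
  exists2 l, T l (- D l) & weakly_converges dot (ergodic_mean lambda x) l.
Proof.
move=> Tmax eta0 Dlip lam0 tauoo fejer [u0 Tu0].
have cvg_dist u : T u (- D u) -> cvgn (fun n => dot (x n - u) (x n - u)).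
  by move=> /fejer; rewrite addNr; exact: quasi_fejer_pair_cvg.
have [m xm] : exists m, forall n, `|x n| <= m.
  have /cvg_seq_bounded [c [_ /(_ (c + 1))]] := cvg_dist _ Tu0.
  rewrite ltrDl ltr01 => /(_ isT) xc.
  exists (`|u0| + (c + 2)) => n.
  have := xc n I; rewrite /= -Hdot => /ler_normlW.
  (* [2 |d| <= |d|^2 + 1] turns the bound on the square into one on the norm. *)
  have := sqr_ge0 (`|x n - u0| - 1).
  have := normr_ge0 (x n - u0); have := ler_normD (x n - u0) u0; rewrite subrK.
  set d := `|_ - _|; lra.
apply: (@opial _ _ _ Hdot _ [set l | T l (- D l)] m).
- exact: ergodic_mean_bounded.
- move=> U l UU oU zl.
  apply: (related_zero_add_lipschitz Hdot Tmax eta0 Dlip) => u t Tut.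
  exact: (quasi_fejer_pair_cluster tauoo (fejer _ _ Tut) UU oU zl).
- move=> a b Ta Tb.
  have /cvg_ex[la Ha] := cvg_dist _ Ta; have /cvg_ex[lb Hb] := cvg_dist _ Tb.
  pose c := 2^-1 * (lb - la + (dot a a - dot b b)).
  have Hc : dot (x n) (a - b) @[n --> \oo] --> c.
    have -> : (fun n => dot (x n) (a - b)) = (fun n =>
        2^-1 * (dot (x n - b) (x n - b) - dot (x n - a) (x n - a) +
                (dot a a - dot b b))).
      by apply/funext => n; rewrite !dotE (dotC a (x n)) (dotC b (x n)); field.
    apply: cvgM; first exact: cvg_cst.
    by apply: cvgD; [exact: cvgB|exact: cvg_cst].
  apply/cvg_ex; exists c.
  rewrite (_ : (fun n => _) = (fun n => (\sum_(1 <= k < n.+1) lambda k)^-1 *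
      \sum_(1 <= k < n.+1) lambda k * dot (x k) (a - b))).
    exact: weighted_mean_cvg.
  by apply/funext => n; rewrite dot_ergodic_mean.
Qed.

End Ergodic.

(** * The forward-backward-forward penalty step *)

Section TsengPenalty.
Context {R : realType} {H : completeNormedModType R}.
Variable dot : {dot H for idfun}.
Hypothesis Hdot : induces_norm dot.

Let dotC := dotC dot.
Let dotE := dotE dot.

(** A normal vector to [C] at [u] attains its support function at [u]. *)
Lemma support_fun_normal_cone (C : set H) (u w : H) (c : R) : 0 <= c ->
  normal_cone dot C u w -> support_fun dot C (c *: w) = (dot (c *: w) u)%:E.
Proof.
move=> c0 [Cu Nw]; apply/eqP; rewrite eq_le; apply/andP; split.
  apply: ge_ereal_sup => _ [y Cy <-]; rewrite lee_fin !(dotZl dot) ler_wpM2l//.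
  by have := Nw y Cy; rewrite (dotDr dot) (dotNr dot); lra.
by apply: ereal_sup_ubound; exists u.
Qed.

(** Evaluating the supremum that defines the Fitzpatrick function at the element
    [(y, v)] of the graph bounds the term of the basic inequality that comes
    from the resolvent of [B].  At [(y, v) = (u, 0)] the left-hand side is
    [0], so that the gap is nonnegative. *)
Lemma fitzpatrick_gap_ge (B : H -> set H) (u w y v : H) (c : R) : 0 <= c ->
  normal_cone dot (zer B) u w -> B y v ->
  ((dot (u - y) v + c * dot w (y - u))%:E <=
   ereal_sup [set fitzpatrick dot B a (c *: w) | a in zer B] -
   support_fun dot (zer B) (c *: w))%E.
Proof.
move=> c0 Nw Byv; rewrite (support_fun_normal_cone c0 Nw) leeBrDr//.
apply: (@le_trans _ _ (fitzpatrick dot B u (c *: w))); last first.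
  by apply: ereal_sup_ubound; exists u => //; case: Nw.
apply: ereal_sup_ubound; exists (y, v) => //=; congr (_%:E).
rewrite !dotE (dotC y w); ring.
Qed.

(** One iteration from [x] to [x'].  Here [dx], [dp] and [du] are the values of
    [D] at [x], [p] and [u], and [p + lam *: (dx - dp) - x'] is [lam * beta]
    times the element of [B x'] given by the second resolvent.  After
    [0 < lam], the hypotheses come from the monotonicity of [A] and [D], the
    Lipschitz continuity of [D] for a small [lam], and the definition of the
    gap [rho].

    Put [a = x - p], [b = p - u], [e = lam *: (dx - dp)], and let [d] be the
    displacement due to [B].  Expanding [|x' - u|^2 = |b + e - d|^2] produces
    the terms [- |a|^2 + |e|^2 - |d|^2], which absorb the cross terms
    [2 lam <g, a>], [- 2 lam <w, e>] and [2 lam <w, d>] by Young's inequality.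
    What has to remain nonnegative is [|a|^2 (1 - 1/4) - 2 |e|^2], hence the
    constant [3 / 8]. *)
Lemma tseng_step (lam rho : R) (x p x' u v w dx dp du : H) : 0 < lam ->
  0 <= dot (p - u) (lam^-1 *: (x - lam *: dx - p) - v) ->
  0 <= dot (p - u) (dp - du) ->
  dot (lam *: (dx - dp)) (lam *: (dx - dp)) <= 3 / 8 * dot (x - p) (x - p) ->
  dot (p + lam *: (dx - dp) - x') (u - x') + lam * dot w (x' - u) <= rho ->
  dot (x' - u) (x' - u) <=
    dot (x - u) (x - u) + 2 * lam * dot (v + w + du) (u - x) +
    (4 * lam ^+ 2 * dot (v + w + du) (v + w + du) + 2 * lam ^+ 2 * dot w w +
     2 * rho).
Proof.
move=> lam0 hA hD hL hB.
pose a := x - p; pose b := p - u; pose e := lam *: (dx - dp).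
pose d := p + e - x'; pose g := v + w + du.
have hAD : 0 <= dot b a - dot b e - lam * dot b g + lam * dot b w.
  have := mulr_ge0 (ltW lam0) hA; have := mulr_ge0 (ltW lam0) hD.
  rewrite addrAC -/a -/b -(dotZr dot lam (lam^-1 *: _ - _)) scalerBr scalerA.
  rewrite divff ?gt_eqF// scale1r /e /g !dotE; lra.
have x'E : x' - u = b + e - d.
  by rewrite /d /b (addrAC p (- u) e) opprB [RHS]addrC subrKA.
have xE : x - u = a + b by rewrite /a /b subrKA.
(* Young's inequality for the three cross terms, in the form of squares. *)
have sq1 := dot_ge0 Hdot (2^-1 *: a - (2 * lam) *: g).
have sq2 := dot_ge0 Hdot (lam *: w + e).
have sq3 := dot_ge0 Hdot (d - lam *: w).
move: hL hB; rewrite -/a -/e -/d -/g -(opprB x u) -(opprB x' u) x'E xE.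
clearbody d; clearbody a b e g => {hA hD x'E xE}; move: hAD sq1 sq2 sq3.
rewrite !dotE ?(dotC b a) ?(dotC e a) ?(dotC e b).
rewrite ?(dotC d a) ?(dotC d b) ?(dotC d e).
rewrite ?(dotC g a) ?(dotC g b) ?(dotC g d) ?(dotC g e) ?(dotC w a) ?(dotC w b).
rewrite ?(dotC w d) ?(dotC w e); lra.
Qed.

End TsengPenalty.

Theorem theorem3 (R : realType) (H : completeNormedModType R)
    (dot : {dot H for idfun}) (Hdot : induces_norm dot)
    (A B : H -> set H) (D : H -> H) (eta : R) (lambda beta : nat -> R)
    (x y p q : nat -> H) :
  let C := zer B in
  let NC := normal_cone dot C in
  let ADN := op_add (op_add A (op_fun D)) NC in
  maximally_monotone_op dot A ->
  maximally_monotone_op dot B ->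
  0 < eta ->
  monotone_op dot (op_fun D) ->
  eta^-1.-lipschitz D ->
  C !=set0 ->
  (forall n, (1 <= n)%N -> 0 < lambda n) ->
  (forall n, (1 <= n)%N -> 0 < beta n) ->
  maximally_monotone_op dot (op_add A NC) ->
  zer ADN !=set0 ->
  (forall w, ran NC w ->
    (\sum_(1 <= n <oo) (lambda n * beta n)%:E *
       (ereal_sup [set fitzpatrick dot B u ((beta n)^-1 *: w) | u in C] -
        support_fun dot C ((beta n)^-1 *: w)) < +oo)%E) ->
  ell 2 lambda ->
  ~ ell 1 lambda ->
  (forall n, (1 <= n)%N ->
    [/\ y n = x n - lambda n *: D (x n),
        p n = resolvent (op_scale (lambda n) A) (y n),
        q n = p n - lambda n *: D (p n) &
        x n.+1 = resolvent (op_scale (lambda n * beta n) B)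
                   (x n - y n + q n)]) ->
  let tau := fun n => \sum_(1 <= k < n.+1) lambda k in
  let z := fun n => (tau n)^-1 *: \sum_(1 <= k < n.+1) lambda k *: x k in
  exists2 xbar, zer ADN xbar & weakly_converges dot z xbar.
Proof.
move=> C NC ADN Amax Bmax eta0 Dmon Dlip _ lam0 beta0 Tmax [u0 ADNu0] gap_sum.
move=> lam2 lam1 iter tau z.
have [lamsq0 [L2 lamsq]] := ell2_cvg0 lam2.
have ADNE u : ADN u 0 <-> op_add A NC u (- D u).
  split.
    move=> [_ [a Aa [_ -> <-]] [w Nw /eqP]].
    rewrite addrAC addr_eq0 => /eqP awE; by exists a => //; exists w.
  move=> [a Aa [w Nw awE]]; exists (a + D u).
    by exists a => //; exists (D u).
  by exists w => //; rewrite addrAC awE addNr.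
(* The solutions are the zeros of [T + D] for [T = A + N_C], so that it is
   enough to establish the basic inequality at the points of the graph of [T]. *)
suff fejer u t : op_add A NC u t -> quasi_fejer_pair dot lambda x u (t + D u).
  have [|l Tl zl] := ergodic_weak_cvg Hdot Tmax eta0 Dlip lam0
    (not_ell1_cvg_pinfty lam0 lam1) fejer; last by exists l => //; apply/ADNE.
  by exists u0; apply/ADNE.
move=> [v Av [w Nw <-]].
pose gap n : \bar R := ((lambda n * beta n)%:E *
       (ereal_sup [set fitzpatrick dot B u ((beta n)^-1 *: w) | u in C] -
        support_fun dot C ((beta n)^-1 *: w)))%E.
have gap_ge n y' v' : (1 <= n)%N -> B y' v' ->
    ((lambda n * beta n * dot (u - y') v' + lambda n * dot w (y' - u))%:E
     <= gap n)%E.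
  move=> n1 Bv; have b0 := beta0 n n1; have l0 := lam0 n n1.
  have -> : lambda n * beta n * dot (u - y') v' + lambda n * dot w (y' - u) =
      lambda n * beta n * (dot (u - y') v' + (beta n)^-1 * dot w (y' - u)).
    by field; rewrite gt_eqF.
  rewrite EFinM lee_pmul2l// ?lte_fin ?mulr_gt0//.
  by apply: (fitzpatrick_gap_ge _ Nw Bv); rewrite invr_ge0 ltW.
have gap_ge0 n : (1 <= n)%N -> (0 <= gap n)%E.
  move=> n1; have [Cu _] := Nw; have := gap_ge n u 0 n1 Cu.
  by rewrite subrr (dot0l dot) (dot0r dot) !mulr0 addr0.
have Rw : ran NC w by exists u.
have [gap_fin [G gapG]] := nneseries_bounded_sums gap_ge0 (gap_sum w Rw).
pose rho n := fine (gap n).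
have rho0 n : (1 <= n)%N -> 0 <= rho n by move=> /gap_ge0; exact: fine_ge0.
have [N _ HN] : \forall n \near \oo, lambda n ^+ 2 <= 3 / 8 * eta ^+ 2.
  by apply: cvgr_le lamsq0 _ _; rewrite mulr_gt0 ?exprn_gt0 ?divr_gt0//.
pose g := v + w + D u.
pose c1 := 4 * dot g g + 2 * dot w w.
have c10 : 0 <= c1 by rewrite addr_ge0 // mulr_ge0 ?dot_ge0.
pose e n := c1 * lambda n ^+ 2 + 2 * rho n.
have e0 n : (1 <= n)%N -> 0 <= e n.
  by move=> n1; rewrite addr_ge0// mulr_ge0 ?sqr_ge0 ?rho0.
(* [N.+1] rather than [N], because the iteration starts at the index [1]. *)
exists N.+1, e, (c1 * L2 + 2 * G); split=> //.
- by move=> n Nn; apply: e0; exact: leq_trans Nn.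
- move=> n Nn; have n1 : (1 <= n)%N by exact: leq_trans Nn.
  have l0 := lam0 n n1; have b0 := beta0 n n1.
  have [yE pE qE xE] := iter n n1.
  have Ap := resolvent_scaleP Hdot (y n) Amax l0.
  have Bx := resolvent_scaleP Hdot (x n - y n + q n) Bmax (mulr_gt0 l0 b0).
  rewrite -pE in Ap; rewrite -xE in Bx.
  have sE : x n - y n + q n = p n + lambda n *: (D (x n) - D (p n)).
    by rewrite yE qE opprB (addrC (x n)) subrK addrCA scalerBr.
  have := @tseng_step _ _ _ Hdot (lambda n) (rho n) (x n) (p n) (x n.+1) u v w
    (D (x n)) (D (p n)) (D u) l0.
  rewrite -/g => /(_ _ _ _ _)/le_trans -> //.
  + by rewrite -yE; exact: Amax.1 Ap Av.
  + exact: Dmon.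
  + rewrite (dotZl dot) (dotZr dot) -!Hdot mulrA -expr2.
    have Dxp : `|D (x n) - D (p n)| <= eta^-1 * `|x n - p n|.
      exact: (Dlip (x n, p n) (conj I I)).
    have etaV0 : 0 <= eta^-1 by rewrite invr_ge0 ltW.
    rewrite -(ler_sqr (y := _ * _)) ?nnegrE ?mulr_ge0// in Dxp.
    apply: le_trans (ler_wpM2l (sqr_ge0 _) Dxp) _.
    rewrite exprMn exprVn mulrA ler_wpM2r ?sqr_ge0// ler_pdivrMr ?exprn_gt0//.
    by apply: HN; exact: ltnW.
  + rewrite -lee_fin -[in leRHS]gap_fin//; apply: le_trans (gap_ge n _ _ n1 Bx).
    rewrite -sE (dotZr dot) mulrA divff ?gt_eqF ?mulr_gt0// mul1r.
    by rewrite (dotC dot (u - _)).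
  + rewrite /e /c1; lra.
- move=> n; rewrite big_split/= -!mulr_sumr lerD// ler_wpM2l//.
    by apply: le_trans (lamsq n); apply: ler_sum_tail => // k _; exact: sqr_ge0.
  by apply: le_trans (gapG n); apply: ler_sum_tail.
Qed.
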